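(* Let $r \ge 2$ be an integer radix, and let $f$ be a function (with values in $\mathbb{R}^m$) that is Lipschitz inside the set $\chi \subseteq \mathbb{R}^m$ with Lipschitz constant $L_f < 1$, i.e. $\|f(x)-f(y)\|_\infty \le L_f \|x-y\|_\infty$ for all $x,y\in\chi$. Suppose $f$ has a fixed point $x^{*} \in \chi$ and is used in the fixed-point iteration $x^{(k+1)} = f(x^{(k)})$, with the symmetric maximally redundant number representation of radix $r$, to generate a sequence of iterates $(x^{(k)})_{k\in\mathbb{N}}$ with $x^{(k)} \in \chi$ for all $k$. Then, given a number of digits $D \ge 1$, there exist an element index $\hat{k} \ge 0$ and a representation of the iterate sequence (a choice of a symmetric maximally redundant radix-$r$ representation of each iterate) such that $$x^{(k)}_{i} = x^{(\hat{k})}_{i} \qquad \text{for all } i \in \{1,\dots,D\} \text{ and all } k > \hat{k}.$$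
   Context: Norm: $\|\cdot\|_\infty$ is the infinity norm on $\mathbb{R}^m$. Symmetric maximally redundant representation of radix $r$: the signed-digit representation with digit set $\{-(r-1),\dots,-1,0,1,\dots,r-1\}$. A real number $v$ is represented by a (finite or infinite) digit string $(v_i)_{i \ge -p}$, for some integer $p\ge 0$, with $v = \sum_{i \ge -p} v_i r^{-i}$; thus the digit with index $i$ has weight $r^{-i}$. Representations are not unique. Digits are indexed so that appending further digits after the digit with index $D$ changes the value by an amount in the interval $(-r^{-D}, r^{-D})$ (for finitely many appended digits). Vectors are represented componentwise, and $x^{(k)}_i$ denotes the $i$-th digit (digit vector, one digit per component) of the chosen representation of $x^{(k)}$. The $D$ most-significant digits are those with indices $1,\dots,D$; any digits to the left of the radix point (indices $\le 0$) count as leading digits and are understood to be unchanged as well. *)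

(* Defs.v *)
From HB Require Import structures.
From mathcomp Require Export all_boot all_order all_algebra.
From mathcomp Require Export all_classical all_reals all_analysis.

Set Implicit Arguments.
Unset Strict Implicit.
Unset Printing Implicit Defensive.

Export Order.TTheory GRing.Theory Num.Theory.
Export numFieldNormedType.Exports.

#[global] Open Scope classical_set_scope.
#[global] Open Scope ring_scope.

Definition sd_digit (r : nat) (a : int) : bool :=
  - (r%:Z - 1) <= a <= r%:Z - 1.

(* [u i] is the digit of weight [r ^ - i], for every integer [i]: the first
   index of a string may be any [- p], with zeros to its left, and a finite
   string is padded on the right with zeros. *)
Definition sd_repr (R : realType) (r : nat) (u : int -> int) (v : R) : Prop :=
  (forall i, sd_digit r (u i)) /\
  exists2 p : nat, (forall i : int, i < - p%:Z -> u i = 0) &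
    series (fun n : nat => (u (n%:Z - p%:Z))%:~R * (r%:R : R) ^ (p%:Z - n%:Z))
      @ \oo --> v.

Definition sd_vrepr (R : realType) (r m : nat) (u : int -> 'rV[int]_m)
    (v : 'rV[R]_m) : Prop :=
  forall j, sd_repr r (fun i => u i 0 j) (v 0 j).

(* Main.v *)
Require Import Defs.
From mathcomp Require Import all_boot all_order all_algebra.
From mathcomp Require Import all_classical all_reals all_analysis.
From mathcomp Require Import ring lra zify.

Set Implicit Arguments.
Unset Strict Implicit.
Unset Printing Implicit Defensive.

(** The fixed-point iteration contracts towards [xstar], so from some index
    [khat] on every iterate is within [r ^ - D / 8] of it, in each component.
    It remains to see that all reals [v] so close to a real [w] have
    representations with the same digits up to index [D].

    A digit string is the same thing as the sequence of its numerators [A i],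
    where [A i * r ^ - i] is the value of the string cut after index [i]: the
    digits are [A i - r * A (i - 1)].  If the integers [A i] stay within [5/8]
    of [v * r ^ i], consecutive numerators differ by a legal digit, because
    [5/8 * (1 + r) < r] for [r >= 2], and the string represents [v]
    ([sd_repr_numerators]).  Rounding to the nearest integer leaves an error of
    at most [1/2], and the slack of [1/8] allows [w * r ^ i] to be rounded
    instead of [v * r ^ i] as long as [i <= D] ([sd_repr_splice]).  The leading
    digits are then those of [w] alone.  With [w = xstar] they are common to all
    iterates from [khat] on. *)

Lemma geometric_lt_eventually (R : realType) (c z e : R) :
  0 <= z < 1 -> 0 < e -> exists N, forall n, (N <= n)%N -> c * z ^+ n < e.
Proof.
move=> /andP[z0 z1] e0.
have z1' : `|z| < 1 by rewrite ger0_norm.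
have /cvgrPdist_lt/(_ e e0) [N _ hN] := cvg_geometric c z1'.
exists N => n Nn; have := hN n Nn.
by rewrite /= sub0r normrN; apply: le_lt_trans; exact: ler_norm.
Qed.

Definition nearest_int (R : realType) (y : R) : int := Num.floor (y + 1 / 2).

Lemma nearest_int_dist (R : realType) (y : R) :
  `|y - (nearest_int y)%:~R| <= 1 / 2.
Proof.
have /andP[] := floor_itv (y + 1 / 2).
rewrite /nearest_int intrD ler_norml => h1 h2.
by apply/andP; split; lra.
Qed.

Definition numerator_digits (r : nat) (A : int -> int) (i : int) : int :=
  A i - r%:Z * A (i - 1).

(** The constant [5/8] may be any number below [2/3]: the worst case of
    [c * (1 + r) < r] is [r = 2]. *)
Lemma numerator_digits_sd_digit (R : realType) (r : nat) (v : R)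
    (A : int -> int) :
  (2 <= r)%N -> (forall i : int, `|v * r%:R ^ i - (A i)%:~R| <= 5 / 8) ->
  forall i, sd_digit r (numerator_digits r A i).
Proof.
move=> hr hA i.
have r2 : 2 <= r%:R :> R by rewrite (ler_nat _ 2).
have r0 : (r%:R : R) != 0 by rewrite gt_eqF//; lra.
have vE : v * r%:R ^ i = r%:R * (v * r%:R ^ (i - 1)).
  by rewrite mulrCA -[in LHS](subrK 1 i) expfzDr// expr1z [r%:R * _]mulrC.
have dE : (numerator_digits r A i)%:~R =
    (A i)%:~R - r%:R * (A (i - 1))%:~R :> R by rewrite intrB intrM.
have : `|(numerator_digits r A i)%:~R : R| < r%:R.
  have := hA i; have := hA (i - 1); rewrite dE vE.
  rewrite !ler_norml ltr_norml => /andP[a1 a2] /andP[b1 b2].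
  by apply/andP; split; nra.
rewrite -intr_norm -[r%:R]/((r%:Z)%:~R) ltr_int ltr_norml /sd_digit.
move=> /andP[l1 l2]; apply/andP; split; lia.
Qed.

(** Far to the left [v * r ^ i] is below [3/8], and an integer within [5/8] of
    it can only be [0]. *)
Lemma numerator_eq0_far_left (R : realType) (r : nat) (v : R)
    (A : int -> int) :
  (2 <= r)%N -> (forall i : int, `|v * r%:R ^ i - (A i)%:~R| <= 5 / 8) ->
  exists p : nat, forall i : int, i < - p%:Z -> A i = 0.
Proof.
move=> hr hA.
have r2 : 2 <= r%:R :> R by rewrite (ler_nat _ 2).
have r_inv : 0 <= (r%:R^-1 : R)%R < 1.
  by rewrite invr_ge0 ler0n/= invf_lt1//; lra.
have [|p hp] := @geometric_lt_eventually R `|v| _ (3 / 8) r_inv; first by lra.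
exists p => i ip.
have small : `|v * r%:R ^ i| < 3 / 8.
  apply: le_lt_trans (hp p (leqnn p)).
  rewrite normrM ler_wpM2l// ger0_norm ?exprz_ge0 ?ler0n//.
  rewrite exprVn exprnN.
  by apply: ler_weXz2l; [lra | exact: ltW].
have : `|(A i)%:~R : R| < 1.
  have := hA i; move: small; rewrite ler_norml !ltr_norml.
  by move=> /andP[? ?] /andP[? ?]; apply/andP; split; lra.
by rewrite -intr_norm -[1]/(1%:~R) ltr_int; lia.
Qed.

(** The digit of index [i] contributes [A i * r ^ - i - A (i - 1) * r ^ - (i - 1)],
    so the sum telescopes. *)
Lemma series_numerator_digits (R : realType) (r : nat) (A : int -> int)
    (p n : nat) :
  (0 < r)%N -> A (- p%:Z - 1) = 0 ->
  series (fun n : nat => (numerator_digits r A (n%:Z - p%:Z))%:~R *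
      (r%:R : R) ^ (p%:Z - n%:Z)) n =
  (A (n%:Z - p%:Z - 1))%:~R * r%:R ^ (p%:Z - n%:Z + 1).
Proof.
move=> r_gt0 A0.
have r0 : (r%:R : R) != 0 by rewrite pnatr_eq0 -lt0n.
pose B k := (A (k%:Z - p%:Z - 1))%:~R * r%:R ^ (p%:Z - k%:Z + 1) : R.
rewrite /series /= (eq_bigr (fun k => B k.+1 - B k)) => [|k _].
  by rewrite telescope_sumr// {2}/B sub0r A0 mul0r subr0.
rewrite /B /numerator_digits intrB intrM.
have -> : k.+1%:Z - p%:Z - 1 = k%:Z - p%:Z by lia.
have -> : p%:Z - k.+1%:Z + 1 = p%:Z - k%:Z by lia.
by rewrite (expfzDr _ 1 r0) expr1z -[(r%:Z)%:~R]/(r%:R); ring.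
Qed.

Lemma sd_repr_numerators (R : realType) (r : nat) (v : R) (A : int -> int) :
  (2 <= r)%N -> (forall i : int, `|v * r%:R ^ i - (A i)%:~R| <= 5 / 8) ->
  sd_repr r (numerator_digits r A) v.
Proof.
move=> hr hA; split; first exact: numerator_digits_sd_digit hA.
have r2 : 2 <= r%:R :> R by rewrite (ler_nat _ 2).
have r0 : (r%:R : R) != 0 by rewrite gt_eqF//; lra.
have r_inv : 0 <= (r%:R^-1 : R)%R < 1.
  by rewrite invr_ge0 ler0n/= invf_lt1//; lra.
have [p hp] := numerator_eq0_far_left hr hA.
exists p => [i ip|].
  by rewrite /numerator_digits !hp ?mulr0 ?subr0//; lia.
apply/cvgrPdist_lt => e e0.
have [N hN] := @geometric_lt_eventually R (r%:R ^ (p%:Z + 1)) _ e r_inv e0.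
exists N => // n /= /hN; apply: le_lt_trans.
rewrite series_numerator_digits ?(ltn_trans _ hr)//; last by apply: hp; lia.
rewrite exprVn exprnN -expfzDr//.
have -> : p%:Z + 1 + - n%:Z = p%:Z - n%:Z + 1 by lia.
set i := n%:Z - p%:Z - 1.
have -> : p%:Z - n%:Z + 1 = - i by rewrite /i; lia.
have ri0 : 0 < (r%:R : R) ^ - i by rewrite exprz_gt0//; lra.
have -> : v = v * r%:R ^ i * r%:R ^ - i.
  by rewrite -mulrA -expfzDr// subrr expr0z mulr1.
rewrite -mulrBl normrM (ger0_norm (ltW ri0)) -[leRHS]mul1r ler_pM2r//.
by apply: le_trans (hA i) _; lra.
Qed.

Definition spliced_numerators (R : realType) (r : nat) (D : nat) (w v : R)
    (i : int) : int :=
  nearest_int ((if i <= D%:Z then w else v) * r%:R ^ i).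

Lemma sd_repr_splice (R : realType) (r D : nat) (w v : R) :
  (2 <= r)%N -> `|v - w| * r%:R ^+ D <= 1 / 8 ->
  sd_repr r (numerator_digits r (spliced_numerators r D w v)) v.
Proof.
move=> hr hvw; apply: sd_repr_numerators => // i.
rewrite /spliced_numerators; case: ifPn => [iD|_]; last first.
  by apply: le_trans (nearest_int_dist _) _; lra.
have r1 : 1 <= r%:R :> R by rewrite (ler_nat _ 1); exact: ltnW.
have ri0 : 0 <= (r%:R : R) ^ i by rewrite exprz_ge0//; lra.
have vw_i : `|v * r%:R ^ i - w * r%:R ^ i| <= 1 / 8.
  rewrite -mulrBl normrM (ger0_norm ri0); apply: le_trans hvw.
  by rewrite ler_wpM2l//; exact: (ler_weXz2l r1 iD).
have := nearest_int_dist (w * r%:R ^ i); move: vw_i.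
rewrite !ler_norml => /andP[? ?] /andP[? ?].
by apply/andP; split; lra.
Qed.

Lemma numerator_digits_splice (R : realType) (r D : nat) (w v v' : R) (i : int) :
  i <= D%:Z ->
  numerator_digits r (spliced_numerators r D w v) i =
  numerator_digits r (spliced_numerators r D w v') i.
Proof.
move=> iD; rewrite /numerator_digits /spliced_numerators iD.
by have -> : i - 1 <= D%:Z by lia.
Qed.

Lemma ler_coord_mx_norm (R : realType) (m n : nat) (x : 'M[R]_(m, n)) i j :
  `|x i j| <= `|x|.
Proof.
rewrite [leRHS]mx_normrE.
exact: (le_bigmax _ (fun ij : 'I_m * 'I_n => `|x ij.1 ij.2|) (i, j)).
Qed.

(** The Lipschitz constant is replaced by its maximum with [0] because a
    negative one is possible when [chi] is a single point. *)
Lemma lipschitz_iterates_dist (R : realType) (V : normedModType R) (f : V -> V)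
    (chi : set V) (L : R) (xstar : V) (x : nat -> V) :
  L.-lipschitz_chi f -> chi xstar -> f xstar = xstar ->
  (forall k, x k.+1 = f (x k)) -> (forall k, chi (x k)) ->
  forall k, `|x k - xstar| <= Num.max 0 L ^+ k * `|x 0 - xstar|.
Proof.
move=> hf hxs hfix hx hchi; elim=> [|k IHk]; first by rewrite expr0 mul1r.
have /= := hf (x k, xstar) (conj (hchi k) hxs); rewrite hfix -hx => step.
apply: (le_trans step); rewrite exprS -mulrA.
apply: (@le_trans _ _ (Num.max 0 L * `|x k - xstar|)).
  by rewrite ler_wpM2r// le_max lexx orbT.
by rewrite ler_wpM2l// le_max lexx.
Qed.

Theorem theorem3 (R : realType) (m r : nat) (hr : (2 <= r)%N)
  (f : 'rV[R]_m -> 'rV[R]_m) (chi : set 'rV[R]_m)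
  (Lf : R) (hLf1 : Lf < 1) (hf : Lf.-lipschitz_chi f)
  (xstar : 'rV[R]_m) (hxstar : chi xstar) (hfix : f xstar = xstar)
  (x : nat -> 'rV[R]_m) (hx : forall k, x k.+1 = f (x k))
  (hchi : forall k, chi (x k))
  (D : nat) (hD : (1 <= D)%N) :
  exists (khat : nat) (d : nat -> int -> 'rV[int]_m),
    (forall k, sd_vrepr r (d k) (x k)) /\
    (forall k, (khat < k)%N -> forall i : int, i <= D%:Z -> d k i = d khat i).
Proof.
have L01 : 0 <= Num.max 0 Lf < 1 by rewrite le_max lexx/= gt_max ltr01.
have [|khat hkhat] :=
  @geometric_lt_eventually R (`|x 0 - xstar| * r%:R ^+ D) _ (1 / 8) L01.
  by lra.
(* Iterates before [khat] need only some representation: each is its own [w]. *)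
pose w k := if (k < khat)%N then x k else xstar.
exists khat, (fun k i => \row_j
  numerator_digits r (spliced_numerators r D (w k 0 j) (x k 0 j)) i).
split=> [k j|k khat_k i iD]; last first.
  apply/rowP => j; rewrite !mxE /w ltnn ltnNge (ltnW khat_k) /=.
  exact: numerator_digits_splice.
under eq_fun do rewrite mxE.
apply: sd_repr_splice => //; rewrite /w; case: ltnP => [_|khat_k].
  by rewrite subrr normr0 mul0r; lra.
apply: le_trans (ltW (hkhat k khat_k)).
rewrite mulrAC ler_wpM2r ?exprn_ge0 ?ler0n// mulrC.
apply: le_trans (lipschitz_iterates_dist hf hxstar hfix hx hchi k).
by have := ler_coord_mx_norm (x k - xstar) 0 j; rewrite !mxE.
Qed.
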